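(* Let $\mathcal{L}$ be a diagonalizable matrix with real eigenvalues $\xi$, let $k\geq 2$ be an integer, and let $\Phi$ (fine grid, time step $h_t$) and $\Psi$ (coarse grid, time step $kh_t$) be the time-propagation operators of two arbitrary, possibly different, Runge--Kutta schemes (each of order at least $1$) applied to $\mathcal{L}$, with eigenvalue functions $\lambda(h_t\xi)$ and $\mu(h_t\xi)$, respectively. Then \[ \lim_{h_t\xi\to 0^+} \frac{|\mu(h_t\xi) - \lambda(h_t\xi)^k|}{1 - |\mu(h_t\xi)|} = 0 \qquad\text{and}\qquad \lim_{h_t\xi\to 0^+} \frac{|\lambda(h_t\xi)^k|\,|\mu(h_t\xi) - \lambda(h_t\xi)^k|}{1 - |\mu(h_t\xi)|} = 0, \] where $h_t\xi$ is regarded as a positive real variable. Equivalently, whenever the limit $h_t\xi\to 0^+$ is equivalent to the limit $\mu(h_t\xi),\lambda(h_t\xi)\to 1^-$ (that is, for positive $h_t\xi$, one has $h_t\xi\to0^+$ if and only if $\mu(h_t\xi)\to1^-$ and $\lambda(h_t\xi)\to 1^-$), both quotients tend to $0$ as $\mu(h_t\xi),\lambda(h_t\xi)\to1^-$.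
   Context: A Runge--Kutta scheme with $s$ stages is given by a real $s\times s$ matrix $A$ and a weight vector $\mathbf{b}\in\mathbb{R}^s$; $\mathbf{1}$ denotes the vector of ones. For the system $\mathbf{u}'(t)+\mathcal{L}\mathbf{u}(t)=f(t)$, the scheme $(A_0,\mathbf{b}_0)$ with time step $h_t$ has time-propagation operator $\Phi = I - h_t(\mathbf{b}_0^T\otimes I)(I+h_tA_0\otimes\mathcal{L})^{-1}(\mathbf{1}\otimes\mathcal{L})$, and the scheme $(A_1,\mathbf{b}_1)$ with time step $kh_t$ has $\Psi = I - kh_t(\mathbf{b}_1^T\otimes I)(I+kh_tA_1\otimes\mathcal{L})^{-1}(\mathbf{1}\otimes\mathcal{L})$. If $\xi$ is an eigenvalue of $\mathcal{L}$, the corresponding eigenvalues of $\Phi$ and $\Psi$ are \[ \lambda(h_t\xi)=1-h_t\xi\,\mathbf{b}_0^T(I+h_t\xi A_0)^{-1}\mathbf{1},\qquad \mu(h_t\xi)=1-kh_t\xi\,\mathbf{b}_1^T(I+kh_t\xi A_1)^{-1}\mathbf{1}. \] These are rational functions of the variable $h_t\xi$. Known fact: if a Runge--Kutta scheme $(A,\mathbf{b})$ has order $p$, then $1-z\mathbf{b}^T(I+zA)^{-1}\mathbf{1}=e^{-z}+\mathcal{O}(z^{p+1})$ as $z\to0$. *)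

(* Defs.v *)
From HB Require Import structures.
From mathcomp Require Export all_boot all_order all_algebra.
From mathcomp Require Export all_classical all_reals all_analysis.
From mathcomp Require Export complex mxtens.

Set Implicit Arguments.
Unset Strict Implicit.
Unset Printing Implicit Defensive.

Export Order.TTheory GRing.Theory Num.Theory.
Export numFieldNormedType.Exports.

Local Open Scope classical_set_scope.
Local Open Scope ring_scope.
Local Open Scope complex_scope.

(* C^m maps. All directional derivatives are required to exist and to be of class
   C^(m - 1), which in finite dimension is the usual notion. *)
Fixpoint classC (R : realType) (V W : normedModType R) (m : nat) (f : V -> W)
    {struct m} : Prop :=
  if m is m'.+1 then
    continuous f /\
    forall v : V, (forall x : V, derivable f x v) /\
                  classC m' (fun x : V => 'D_v f x)
  else continuous f.

Definition smooth (R : realType) (V W : normedModType R) (f : V -> W) : Prop :=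
  forall m : nat, classC m f.

Definition complex_mx (R : realType) (m n : nat) (M : 'M[R]_(m, n)) :
  'M[R[i]]_(m, n) := map_mx (real_complex R) M.

(* A scheme is given by the pair (A, b) alone: the abscissae are A *m 1, so that
   a non-autonomous problem is the autonomous one with t adjoined to the
   unknowns, and it is enough to consider u' = F(u). *)
Section RungeKutta.
Variables (R : realType) (s : nat) (A : 'M[R]_s) (b : 'cV[R]_s).

(* K h i is the i-th stage slope for the time step h. For an implicit scheme the
   stage equations may have several solutions; the limit condition selects the
   branch issued from h = 0, which exists and is unique for all small h. *)
Definition stage_slopes (d : nat) (F : 'rV[R]_d -> 'rV[R]_d) (u0 : 'rV[R]_d)
    (K : R -> 'I_s -> 'rV[R]_d) : Prop :=
  (\forall h \near 0^'+,
     forall i, K h i = F (u0 + h *: \sum_j A i j *: K h j)) /\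
  (forall i, K h i @[h --> 0^'+] --> F u0).

(* Order at least p: for every smooth system the error committed in one step
   is O(h ^ (p + 1)). *)
Definition has_order (p : nat) : Prop :=
  forall (d : nat) (F : 'rV[R]_d -> 'rV[R]_d) (u0 : 'rV[R]_d)
         (u : R -> 'rV[R]_d) (K : R -> 'I_s -> 'rV[R]_d),
    smooth F ->
    u 0 = u0 ->
    (\forall t \near 0, is_derive t (1 : R) u (F (u t))) ->
    stage_slopes F u0 K ->
    exists C : R, \forall h \near 0^'+,
      `|u0 + h *: \sum_i b i 0 *: K h i - u h| <= C * h ^+ p.+1.

(* Kronecker products *t identify C^s (x) C^n with C^(s * n); the cast only
   removes the dimension 1 * n of C^1 (x) C^n. *)
Definition propagation (n : nat) (h : R) (L : 'M[R[i]]_n) : 'M[R[i]]_n :=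
  1%:M - castmx (mul1n n, mul1n n)
           (h%:C *: ((complex_mx b)^T *t (1%:M : 'M[R[i]]_n)
                     *m invmx (1%:M + h%:C *: (complex_mx A *t L))
                     *m ((const_mx 1 : 'cV[R[i]]_s) *t L))).

(* The stage system of a step of size h for u' + L u = f is uniquely solvable;
   otherwise invmx in propagation is meaningless. *)
Definition well_posed (n : nat) (h : R) (L : 'M[R[i]]_n) : Prop :=
  1%:M + h%:C *: (complex_mx A *t L) \in unitmx.

(* The eigenvalue of the propagation operator attached to an eigenvalue xi of L is
   the value of this rational function at z = h * xi. At its finitely many
   poles, none of which is near 0, invmx returns a junk value. *)
Definition stability (z : R) : R :=
  1 - z * (b^T *m invmx (1%:M + z *: A) *m (const_mx 1 : 'cV[R]_s)) 0 0.

End RungeKutta.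

(* Main.v *)
(* If v L = xi v then (y (x) v)(I + h A (x) L) = y (I + h xi A) (x) v, so v is
   also an eigenvector of the propagation operator; since L has an eigenbasis,
   every eigenvalue arises in this way. Order one, tested on the equation u' = 1,
   forces the weights to sum to 1. Hence lambda z = 1 - z f z and
   mu z = 1 - k z g z with f and g tending to 1, and for small z > 0 the first
   quotient equals |f z (1 + lambda z + ... + lambda z ^ (k - 1)) - k g z| / (k g z),
   which tends to |k - k| / k = 0. *)
Require Import Defs.
From mathcomp Require Import ring.

Set Implicit Arguments.
Unset Strict Implicit.
Unset Printing Implicit Defensive.

Local Open Scope classical_set_scope.
Local Open Scope ring_scope.
Local Open Scope complex_scope.

(** * Casts and Kronecker products *)

Lemma castmx_mulmx (F : pzRingType) m m' n n' p p' (em : m = m') (en : n = n')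
    (ep : p = p') (M : 'M[F]_(m, n)) (N : 'M[F]_(n, p)) :
  castmx (em, en) M *m castmx (en, ep) N = castmx (em, ep) (M *m N).
Proof. by case: _ / em; case: _ / en; case: _ / ep; rewrite !castmx_id. Qed.

Lemma castmxZ (F : pzRingType) m m' n n' (em : m = m') (en : n = n') (a : F)
    (M : 'M[F]_(m, n)) :
  castmx (em, en) (a *: M) = a *: castmx (em, en) M.
Proof. by case: _ / em; case: _ / en; rewrite !castmx_id. Qed.

Section Tensor.
Variables (F : fieldType) (m n p q : nat).
Implicit Types (A : 'M[F]_(m, n)) (B : 'M[F]_(p, q)).

Lemma tensmxDl A1 A2 B : (A1 + A2) *t B = A1 *t B + A2 *t B.
Proof. by apply/matrixP => i j; rewrite !mxE mulrDl. Qed.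

Lemma tensmxZl a A B : (a *: A) *t B = a *: (A *t B).
Proof. by apply/matrixP => i j; rewrite !mxE mulrA. Qed.

Lemma tensmxZr a A B : A *t (a *: B) = a *: (A *t B).
Proof. by apply/matrixP => i j; rewrite !mxE mulrCA. Qed.

(** A nonzero entry of [B] singles out, inside [A *t B], a copy of [A] scaled by that entry. *)
Lemma tensmx_eq0l A B : B != 0 -> A *t B = 0 -> A = 0.
Proof.
case/matrix0Pn=> k [l Bkl] /matrixP AB; apply/matrixP => i j.
have := AB (mxtens_index (i, k)) (mxtens_index (j, l)).
by rewrite tensmxE !mxE => /eqP; rewrite mulf_eq0 (negbTE Bkl) orbF => /eqP.
Qed.

End Tensor.

(** * Spectrum of the propagation operator *)

(** The rows of [P] form an eigenbasis of [L] and are eigenvectors of [M] too, so [M] is diagonal in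
    this basis with the values of [g] on the diagonal. *)
Lemma eigenvalue_diagonalizable (F : fieldType) n (L M : 'M[F]_n) (g : F -> F) :
    diagonalizable L ->
    (forall (v : 'rV_n) x, v != 0 -> v *m L = x *: v -> v *m M = g x *: v) ->
  forall y, eigenvalue M y <-> exists x, eigenvalue L x /\ y = g x.
Proof.
case=> P Pu /diagonalizable_forPex[D /(simmxP Pu) PL] gM y; split; last first.
  move=> [x [/eigenvalueP[v vL v0] ->]].
  by apply/eigenvalueP; exists v => //; exact: gM.
case/eigenvalueP=> v vM v0.
have rowP_neq0 i : row i P != 0.
  apply/eqP => Pi0; have := row_mul i P (invmx P).
  rewrite mulmxV // Pi0 mul0mx => /rowP/(_ i); rewrite !mxE eqxx => /eqP.
  by rewrite oner_eq0.
have rowPL i : row i P *m L = D 0 i *: row i P.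
  by rewrite -row_mul PL mul_diag_mx; apply/rowP => j; rewrite !mxE.
have PM : P *m M = diag_mx (map_mx g D) *m P.
  apply/row_matrixP => i; rewrite row_mul (gM _ _ (rowP_neq0 i) (rowPL i)).
  by rewrite mul_diag_mx; apply/rowP => j; rewrite !mxE.
(* [w] holds the coordinates of [v] in the eigenbasis; any nonzero coordinate identifies [y] as the
   value of [g] at the matching diagonal entry. *)
have [w wP] : exists w, w *m P = v by exists (v *m invmx P); rewrite mulmxKV.
have wD : w *m diag_mx (map_mx g D) = y *: w.
  apply: (can_inj (mulmxK Pu)).
  by rewrite -mulmxA -PM mulmxA wP vM -scalemxAl wP.
have : w != 0 by apply: contraNneq v0 => w0; rewrite -wP w0 mul0mx.
case/rV0Pn => i wi0; exists (D 0 i); split.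
  by apply/eigenvalueP; exists (row i P).
by move/rowP/(_ i): wD; rewrite mul_mx_diag !mxE mulrC => /(mulIf wi0).
Qed.

Section Stage.
Variables (F : fieldType) (s n : nat) (A : 'M[F]_s) (L : 'M[F]_n) (h xi : F).
Variable (v : 'rV[F]_n).
Hypotheses (v0 : v != 0) (vL : v *m L = xi *: v).

Lemma tens_eigenvector p (y : 'M[F]_(p, s)) :
  (y *t v) *m (1%:M + h *: (A *t L)) = (y *m (1%:M + (h * xi) *: A)) *t v.
Proof.
rewrite !mulmxDr !mulmx1 -!scalemxAr tensmx_mul vL tensmxZr scalerA.
by rewrite tensmxDl tensmxZl.
Qed.

(** A row [y] killed by the small matrix gives [y *t v], killed by the invertible stage matrix;
    since [v] is nonzero, [y = 0]. *)
Lemma unitmx_stage : 1%:M + h *: (A *t L) \in unitmx ->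
  1%:M + (h * xi) *: A \in unitmx.
Proof.
move=> Mu; rewrite -row_free_unit; apply: inj_row_free => y yA0.
apply: (tensmx_eq0l v0); apply: (can_inj (mulmxK Mu)).
by rewrite mul0mx tens_eigenvector yA0 tens0mx.
Qed.

Lemma tens_invmx p (y : 'M[F]_(p, s)) : 1%:M + h *: (A *t L) \in unitmx ->
  (y *t v) *m invmx (1%:M + h *: (A *t L)) =
  (y *m invmx (1%:M + (h * xi) *: A)) *t v.
Proof.
move=> Mu; apply: (can_inj (mulmxK Mu)).
by rewrite tens_eigenvector !mulmxKV// unitmx_stage.
Qed.

End Stage.

(** Carries the expression inside [stability] from the reals to the complex numbers, where
    [propagation] lives. *)
Lemma map_mx_stage (F K : fieldType) (f : {rmorphism F -> K}) s (A : 'M[F]_s)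
    (b : 'cV[F]_s) (z : F) :
  (map_mx f b)^T *m invmx (1%:M + f z *: map_mx f A) *m const_mx 1 =
  map_mx f (b^T *m invmx (1%:M + z *: A) *m (const_mx 1 : 'cV[F]_s)).
Proof.
rewrite !map_mxM map_trmx map_invmx map_mxD map_mx1 map_mxZ map_const_mx.
by rewrite rmorph1.
Qed.

Lemma propagation_eigenvector (R : realType) (s n : nat) (A : 'M[R]_s)
    (b : 'cV[R]_s) (h : R) (L : 'M[R[i]]_n) (xi : R) (v : 'rV[R[i]]_n) :
  well_posed A h L -> v != 0 -> v *m L = xi%:C *: v ->
  v *m propagation A b h L = (stability A b (h * xi))%:C *: v.
Proof.
move=> Mu v0 vL; rewrite /propagation mulmxBr mulmx1.
set X := _ *m _ *m (_ *t L).
(* Writing [v] as a cast of [1 *t v] lets the mixed-product rule apply to each Kronecker factor of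
   [X]. *)
have vE : v = castmx (mul1n 1, mul1n n) ((1%:M : 'M[R[i]]_1) *t v).
  by rewrite tens_scalar_mx castmxKV scale1r.
rewrite {2}vE castmx_mulmx -scalemxAr /X !mulmxA tensmx_mul mulmx1 mul1mx.
rewrite (tens_invmx v0 vL _ Mu) tensmx_mul vL tensmxZr.
set c := _ *m _ *m const_mx 1.
(* [c] is a 1 by 1 matrix, hence scalar, and its entry is the image of a real number. *)
have -> : c = ((b^T *m invmx (1%:M + (h * xi) *: A) *m
                (const_mx 1 : 'cV[R]_s)) 0 0)%:C%:M.
  by rewrite [LHS]mx11_scalar /c -rmorphM map_mx_stage mxE.
rewrite -[X in X *t v]scalemx1 tensmxZl !scalerA castmxZ -vE.
rewrite -[X in X - _]scale1r -scalerBl.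
by rewrite /stability rmorphB rmorph1 !rmorphM.
Qed.

Lemma eigenvalue_propagation (R : realType) (s n : nat) (A : 'M[R]_s)
    (b : 'cV[R]_s) (h : R) (L : 'M[R[i]]_n) :
  diagonalizable L ->
  (forall x : R[i], eigenvalue L x -> x \is Num.real) ->
  well_posed A h L -> forall x : R[i],
    eigenvalue (propagation A b h L) x <->
    exists xi : R, eigenvalue L xi%:C /\ x = (stability A b (h * xi))%:C.
Proof.
move=> Ld Lr Mu x.
(* [stability] takes a real argument; as the eigenvalues of [L] are real, taking the real part does
   not change them. *)
pose g (y : R[i]) := (stability A b (h * complex.Re y))%:C.
have gM (v : 'rV_n) y : v != 0 -> v *m L = y *: v ->
    v *m propagation A b h L = g y *: v.
  move=> v0 vL; apply: propagation_eigenvector => //.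
  by rewrite RRe_real// Lr//; apply/eigenvalueP; exists v.
have [Mx xM] := eigenvalue_diagonalizable Ld gM x.
split.
  move=> /Mx[y [Ly xE]]; exists (complex.Re y).
  split; first by rewrite RRe_real ?Lr.
  exact: xE.
move=> [xi [Lxi xE]]; apply: xM; exists xi%:C; split; first exact: Lxi.
exact: xE.
Qed.

(** * Order one and the sum of the weights *)

Lemma smooth_cst (R : realType) (V W : normedModType R) (c : W) :
  smooth (fun _ : V => c).
Proof.
move=> m; elim: m c => [|m IH] c /=; first exact: cst_continuous.
split; first exact: cst_continuous.
move=> v; split=> [x|]; first exact: derivable_cst.
have -> : (fun x : V => 'D_v (fun _ : V => c) x) = fun _ => 0 :> W.
  by apply/funext => x; rewrite derive_cst.
exact: IH.
Qed.

Lemma is_derive_scale (R : realType) (V : normedModType R) (c : V) (t : R) :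
  is_derive t (1 : R) (fun x => x *: c) c.
Proof.
have q : h^-1 *: (((fun x => x *: c) \o shift t) (h *: (1 : R)) - t *: c)
    @[h --> (0 : R)^'] --> c.
  apply: cvg_near_cst; near=> h => /=.
  have h0 : h != 0 by near: h; exact: nbhs_dnbhs_neq.
  by rewrite [h *: 1]mulr1 scalerDl addrK scalerA mulVf// scale1r.
by split; [exact: cvgP q|exact: cvg_lim q].
Unshelve. all: by end_near.
Qed.

(** For [u' = 1] from 0 every stage slope is 1, and a step has error proportional to [h |S - 1|],
    where [S] is the sum of the weights. A bound [C h^2] on this error is impossible for small [h]
    unless [S = 1]. *)
Lemma has_order1_sum (R : realType) s (A : 'M[R]_s) (b : 'cV[R]_s) :
  has_order A b 1 -> \sum_i b i 0 = 1.
Proof.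
move=> /(_ 1%N (fun=> const_mx 1) 0 (fun t => t *: const_mx 1)
  (fun _ _ => const_mx 1)) [].
- exact: smooth_cst.
- by rewrite scale0r.
- by near=> t; exact: is_derive_scale.
- split; first by near=> h => i.
  by move=> i; exact: cvg_cst.
move=> C Cb; set S := \sum_i _; apply/eqP; rewrite -subr_eq0; apply/negPn/negP => S1.
have c_gt0 : 0 < `|const_mx 1 : 'rV[R]_1|.
  rewrite normr_gt0; apply/eqP => /rowP/(_ 0); rewrite !mxE => /eqP.
  by rewrite oner_eq0.
have Ch : C * h @[h --> 0^'+] --> (0 : R).
  rewrite -[X in _ --> X](mulr0 C); apply: cvg_at_right_filter.
  by apply: cvgM; [exact: cvg_cst|exact: cvg_id].
near (0 : R)^'+ => h.
have h_gt0 : 0 < h by near: h; exact: nbhs_right_gt.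
have : C * h < `|S - 1| * `|const_mx 1 : 'rV[R]_1|.
  by near: h; apply: cvgr_lt Ch _ _; rewrite mulr_gt0// normr_gt0.
rewrite ltNge => /negP; apply.
have : `|0 + h *: (\sum_i b i 0 *: const_mx 1) - h *: const_mx 1 : 'rV[R]_1|
    <= C * h ^+ 2 by near: h.
rewrite add0r -scaler_suml -scalerBr -[X in _ - X]scale1r -scalerBl !normrZ.
by rewrite (gtr0_norm h_gt0) expr2 [C * _]mulrCA ler_pM2l.
Unshelve. all: by end_near.
Qed.

(** * Limits at zero *)

(** By Cramer's rule the expression is a quotient of two polynomials in [z] near 0. The denominator
    is 1 at 0, so the quotient is continuous there. *)
Lemma cvg_slope (R : realType) s (A : 'M[R]_s) (b : 'cV[R]_s) :
  (b^T *m invmx (1%:M + z *: A) *m (const_mx 1 : 'cV[R]_s)) 0 0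
    @[z --> (0 : R)] --> \sum_i b i 0.
Proof.
pose M := 1%:M + 'X *: map_mx polyC A : 'M[{poly R}]_s.
pose N := (map_mx polyC b^T *m \adj M *m (const_mx 1 : 'cV_s)) 0 0.
(* Evaluation at [z] is a ring morphism, so it commutes with determinants and adjugates. *)
have ME z : map_mx (horner_eval z) M = 1%:M + z *: A.
  apply/matrixP => i j; rewrite !mxE /horner_eval !hornerE.
  by rewrite mulrb; case: eqP => _; rewrite ?hornerE.
have dE z : (\det M).[z] = \det (1%:M + z *: A).
  by rewrite -ME det_map_mx.
have NE z : N.[z] = (b^T *m \adj (1%:M + z *: A) *m (const_mx 1 : 'cV_s)) 0 0.
  rewrite -ME -map_mx_adj -[N.[z]]/(horner_eval z N) /N.
  transitivity (map_mx (horner_eval z)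
     (map_mx polyC b^T *m \adj M *m (const_mx 1 : 'cV_s)) 0 0).
    by rewrite !mxE.
  have bE : map_mx (horner_eval z) (map_mx polyC b^T) = b^T.
    by apply/matrixP => i j; rewrite !mxE /horner_eval hornerC.
  by rewrite !map_mxM map_const_mx rmorph1 bE.
have -> : \sum_i b i 0 = N.[0] / (\det M).[0].
  rewrite dE NE scale0r addr0 det1 divr1 adj1 mulmx1 mxE.
  by apply: eq_bigr => i _; rewrite !mxE mulr1.
have d0 : (\det M).[0] != 0 by rewrite dE scale0r addr0 det1 oner_eq0.
have dc : (\det M).[z] @[z --> (0 : R)] --> (\det M).[0].
  exact: continuous_horner.
have Nc : N.[z] @[z --> (0 : R)] --> N.[0] by exact: continuous_horner.
apply: cvg_trans (cvgM Nc (cvgV d0 dc)).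
apply: near_eq_cvg; near=> z => /=.
(* A nonzero determinant ensures that [invmx] is the adjugate over the determinant and not its
   default value. *)
have dz : (\det M).[z] != 0 by near: z; exact: cvgr_neq0 dc d0.
rewrite /invmx unitmxE -dE unitfE dz NE -scalemxAr -scalemxAl.
by rewrite [RHS]mxE mulrC.
Unshelve. all: by end_near.
Qed.

Lemma cvg_one_sub_mul (R : realType) (T : Type) (F : set_system T)
    {FF : Filter F} (z f : T -> R) :
  z x @[x --> F] --> (0 : R) -> f x @[x --> F] --> (1 : R) ->
  1 - z x * f x @[x --> F] --> (1 : R).
Proof.
move=> z0 f1; rewrite -[X in _ --> X](subr0 (1 : R)) -(mul0r (1 : R)).
by apply: cvgB; [exact: cvg_cst|exact: cvgM].
Qed.

(** Both [1 - (1 - z f)^k] and [k z g] are [k z] to first order, so the numerator is [o(z)] while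
    the gap in the denominator is of size [k z]. *)
Lemma defect_over_gap_cvg0 (R : realType) (k : nat) (f g : R -> R)
    (F : set_system R) {FF : Filter F} :
  (0 < k)%N -> (\forall z \near F, 0 < z) -> z @[z --> F] --> (0 : R) ->
  f z @[z --> F] --> (1 : R) -> g z @[z --> F] --> (1 : R) ->
  `|1 - k%:R * z * g z - (1 - z * f z) ^+ k| / (1 - `|1 - k%:R * z * g z|)
    @[z --> F] --> (0 : R).
Proof.
move=> k_gt0 F0 z0 f1 g1.
have k0 : k%:R != 0 :> R by rewrite pnatr_eq0 -lt0n.
(* [p = 1 + X + ... + X^(k-1)], with [p(1) = k]. *)
pose p : {poly R} := \poly_(i < k) 1.
have l1 : 1 - z * f z @[z --> F] --> (1 : R) by exact: cvg_one_sub_mul.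
have kz0 : k%:R * z @[z --> F] --> (0 : R).
  by rewrite -[X in _ --> X](mulr0 k%:R); apply: cvgM z0; exact: cvg_cst.
have m1 : 1 - k%:R * z * g z @[z --> F] --> (1 : R).
  exact: cvg_one_sub_mul.
have pk : p.[1 - z * f z] @[z --> F] --> (k%:R : R).
  have -> : k%:R = p.[1].
    rewrite horner_poly; under eq_bigr do rewrite expr1n mulr1.
    by rewrite sumr_const card_ord.
  by apply: continuous_cvg => //; exact: continuous_horner.
have num : `|f z * p.[1 - z * f z] - k%:R * g z| @[z --> F] -->
    (`|1 * k%:R - k%:R * 1| : R).
  apply: cvg_norm; apply: cvgB; first exact: cvgM.
  by apply: cvgM => //; exact: cvg_cst.
have den : (k%:R * g z)^-1 @[z --> F] --> ((k%:R * 1)^-1 : R).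
  apply: cvgV; first by rewrite mulr1.
  by apply: cvgM => //; exact: cvg_cst.
rewrite mul1r mulr1 subrr normr0 in num; rewrite -(mul0r (k%:R * 1)^-1).
apply: cvg_trans (cvgM num den).
apply: near_eq_cvg; near=> z => /=.
have z_gt0 : 0 < z by near: z.
(* Positivity removes the absolute value, so that the gap is exactly [k z g z]. *)
have m_gt0 : 0 < 1 - k%:R * z * g z by near: z; apply: cvgr_gt m1 _ _.
rewrite (gtr0_norm m_gt0) subKr.
(* The geometric sum gives [1 - l^k = (1 - l) p(l)] with [l = 1 - z f z], which brings out the
   factor [z] to be cancelled. *)
have -> : 1 - k%:R * z * g z - (1 - z * f z) ^+ k =
    z * (f z * p.[1 - z * f z] - k%:R * g z).
  rewrite horner_poly; under eq_bigr do rewrite mul1r.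
  have := subrX1 (1 - z * f z) k; set S := \sum_(i < k) _ => /eqP.
  rewrite subr_eq => /eqP ->; ring.
rewrite normrM (gtr0_norm z_gt0).
have -> : k%:R * z * g z = z * (k%:R * g z) by ring.
by rewrite -mulf_div divff ?mul1r// gt_eqF.
Unshelve. all: by end_near.
Qed.

Theorem corollary1 (R : realType) (n : nat) (L : 'M[R[i]]_n)
    (s0 s1 : nat) (A0 : 'M[R]_s0) (b0 : 'cV[R]_s0)
    (A1 : 'M[R]_s1) (b1 : 'cV[R]_s1) (k : nat)
    (L_diag : diagonalizable L)
    (L_real : forall x : R[i], eigenvalue L x -> x \is Num.real)
    (k_ge2 : (2 <= k)%N)
    (order0 : has_order A0 b0 1) (order1 : has_order A1 b1 1) :
  let Phi (h : R) := propagation A0 b0 h L in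
  let Psi (h : R) := propagation A1 b1 (k%:R * h) L in
  let lambda (z : R) := stability A0 b0 z in
  let mu (z : R) := stability A1 b1 (k%:R * z) in
  let q1 (z : R) := `|mu z - lambda z ^+ k| / (1 - `|mu z|) in
  let q2 (z : R) :=
    `|lambda z ^+ k| * `|mu z - lambda z ^+ k| / (1 - `|mu z|) in
  [/\ forall h : R, 0 < h -> well_posed A0 h L -> forall x : R[i],
        eigenvalue (Phi h) x <->
        exists xi : R, eigenvalue L xi%:C /\ x = (lambda (h * xi))%:C,
      forall h : R, 0 < h -> well_posed A1 (k%:R * h) L -> forall x : R[i],
        eigenvalue (Psi h) x <->
        exists xi : R, eigenvalue L xi%:C /\ x = (mu (h * xi))%:C,
      q1 z @[z --> 0^'+] --> 0 /\ q2 z @[z --> 0^'+] --> 0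
    & (forall F : set_system R, Filter F -> (\forall z \near F, 0 < z) ->
         (F --> 0^'+ <->
          mu z @[z --> F] --> 1^'- /\ lambda z @[z --> F] --> 1^'-)) ->
      forall F : set_system R, Filter F -> (\forall z \near F, 0 < z) ->
        mu z @[z --> F] --> 1^'- -> lambda z @[z --> F] --> 1^'- ->
        q1 z @[z --> F] --> 0 /\ q2 z @[z --> F] --> 0].
Proof.
move=> Phi Psi lambda mu q1 q2.
have z0 : z @[z --> (0 : R)^'+] --> (0 : R).
  by apply: cvg_at_right_filter; exact: cvg_id.
have k_gt0 : (0 < k)%N by exact: leq_trans k_ge2.
have f1 := cvg_at_right_filter (@cvg_slope _ _ A0 b0).
rewrite (has_order1_sum order0) in f1.
have q1_0 : q1 z @[z --> 0^'+] --> 0.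
  have g1 := @cvg_slope _ _ A1 b1; rewrite (has_order1_sum order1) in g1.
  have kz0 : k%:R * z @[z --> (0 : R)^'+] --> (0 : R).
    by rewrite -[X in _ --> X](mulr0 k%:R); apply: cvgM z0; exact: cvg_cst.
  (* The coarse scheme is evaluated at [k z], so its [g] is the slope expression composed with
     [z -> k z]. *)
  apply: (defect_over_gap_cvg0 k_gt0 _ z0 f1 (cvg_comp _ _ kz0 g1)).
  exact: nbhs_right_gt.
have q2_0 : q2 z @[z --> 0^'+] --> 0.
  have lk1 : `|lambda z ^+ k| @[z --> 0^'+] --> (`|1 ^+ k| : R).
    have l1 : lambda z @[z --> 0^'+] --> (1 : R) by exact: cvg_one_sub_mul.
    apply: cvg_norm.
    by apply: (cvg_comp lambda (fun y => y ^+ k) l1); exact: exprn_continuous.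
  (* The extra factor tends to 1, so the limit of [q2] follows from that of [q1]. *)
  have -> : q2 = (fun z => `|lambda z ^+ k| * q1 z).
    by apply/funext => z; rewrite /q2 -mulrA.
  have q1lk := cvgM lk1 q1_0; rewrite mulr0 in q1lk.
  exact: q1lk.
split.
- by move=> h h0 Mu x; exact: eigenvalue_propagation.
- move=> h h0 Mu x.
  have [Mx xM] := eigenvalue_propagation b1 L_diag L_real Mu x.
  split=> [/Mx|] [xi [Lxi xE]].
    by exists xi; rewrite /mu mulrA.
  by apply: xM; exists xi; rewrite -mulrA.
- by [].
(* The assumed equivalence, applied to [F] itself, yields [F --> 0^'+]; both limits at [0^'+] then
   transfer to [F]. *)
- move=> H F FF F0 mF lF; have F00 : F --> 0^'+ by apply/(H F FF F0).
  by split; [exact: cvg_comp F00 q1_0|exact: cvg_comp F00 q2_0].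
Qed.
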